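(* Let $X=(x_i)_{i=1}^\infty$ be a sequence of non-negative integers, regarded as the sequence $a=(a_n)_{n=0}^\infty$ with $a_n=x_{n+1}$, and let $b=(b_n)_{n=0}^\infty=I(a)$ be its image under the Invert operator $I$. Then for every $n\ge 1$, $$b_{n-1}=\sum_{k_1+2k_2+\cdots+nk_n=n}\frac{(k_1+\cdots+k_n)!}{k_1!\cdots k_n!}\,x_1^{k_1}\cdots x_n^{k_n},$$ where the sum is over all $n$-tuples $(k_1,\ldots,k_n)$ of non-negative integers with $k_1+2k_2+\cdots+nk_n=n$.
   Context: The Invert operator $I$ transforms a sequence $a=(a_n)_{n=0}^\infty$ into the sequence $b=(b_n)_{n=0}^\infty$ determined by $\sum_{n\ge 0}b_nt^n=\dfrac{\sum_{n\ge 0}a_nt^n}{1-t\sum_{n\ge 0}a_nt^n}$ (as formal power series). The convention $0^0=1$ is used. *)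

(* Defs.v *)
From mathcomp Require Import all_boot all_order all_algebra.

Set Implicit Arguments.
Unset Strict Implicit.
Unset Printing Implicit Defensive.

Import GRing.Theory.
Local Open Scope ring_scope.

(* A formal power series over R is its coefficient sequence nat -> R. *)

Definition fps_one (R : nzRingType) : nat -> R := fun n => (n == 0)%:R.

Definition fps_t (R : nzRingType) : nat -> R := fun n => (n == 1)%:R.

Definition fps_sub (R : nzRingType) (f g : nat -> R) : nat -> R :=
  fun n => f n - g n.

Definition fps_mul (R : nzRingType) (f g : nat -> R) : nat -> R :=
  fun n => \sum_(i < n.+1) f i * g (n - i)%N.

(* The first n coefficients of f / g, by long division: the coefficient of
   degree m is (f_m - sum_(i < m) (f / g)_i g_(m - i)) / g_0. *)
Fixpoint fps_div_seq (R : comUnitRingType) (f g : nat -> R) (n : nat) : seq R :=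
  if n is m.+1 then
    let s := fps_div_seq f g m in
    rcons s ((f m - \sum_(i < m) s`_i * g (m - i)%N) / g 0)
  else [::].

(* Meaningful when g 0 is a unit, see fps_divP. *)
Definition fps_div (R : comUnitRingType) (f g : nat -> R) : nat -> R :=
  fun n => (fps_div_seq f g n.+1)`_n.

Definition Invert (R : comUnitRingType) (a : nat -> R) : nat -> R :=
  fps_div a (fps_sub (@fps_one R) (fps_mul (@fps_t R) a)).

Lemma size_fps_div_seq (R : comUnitRingType) (f g : nat -> R) n :
  size (fps_div_seq f g n) = n.
Proof. by elim: n => //= n IHn; rewrite size_rcons IHn. Qed.

Lemma nth_fps_div_seq (R : comUnitRingType) (f g : nat -> R) n i :
  (i < n)%N -> (fps_div_seq f g n)`_i = fps_div f g i.
Proof.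
elim: n => // n IHn; rewrite ltnS leq_eqVlt => /predU1P[-> //|lt_in].
by rewrite /= nth_rcons size_fps_div_seq lt_in IHn.
Qed.

Lemma fps_divE (R : comUnitRingType) (f g : nat -> R) n :
  fps_div f g n = (f n - \sum_(i < n) fps_div f g i * g (n - i)%N) / g 0.
Proof.
rewrite {1}/fps_div /= nth_rcons size_fps_div_seq ltnn eqxx.
by congr ((_ - _) / _); apply: eq_bigr => i _; rewrite nth_fps_div_seq.
Qed.

Lemma fps_divP (R : comUnitRingType) (f g h : nat -> R) :
  g 0 \is a GRing.unit -> (h =1 fps_div f g) <-> (fps_mul h g =1 f).
Proof.
move=> Ug; split=> [hE n | hg].
  rewrite /fps_mul big_ord_recr /= subnn hE fps_divE divrK //.
  by under eq_bigr do rewrite hE; rewrite addrC subrK.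
elim/ltn_ind=> n IHn; rewrite fps_divE -hg /fps_mul big_ord_recr /= subnn.
rewrite (eq_bigr (fun i : 'I_n => fps_div f g i * g (n - i)%N)).
  by rewrite addrAC subrr add0r mulrK.
by move=> i _; rewrite IHn.
Qed.

Lemma InvertP (R : comUnitRingType) (a b : nat -> R) :
  (b =1 Invert a) <->
  (fps_mul b (fps_sub (@fps_one R) (fps_mul (@fps_t R) a)) =1 a).
Proof.
apply: fps_divP.
by rewrite /fps_sub /fps_mul /fps_one /fps_t big_ord1 mul0r subr0 unitr1.
Qed.

(* Solutions of k_1 + 2 k_2 + ... + n k_n = n, written with 0-based indices,
   have all k_j <= n, so the finite functions 'I_n -> 'I_n.+1 contain all of
   them. *)
Lemma weight_bound (n : nat) (k : 'I_n -> nat) :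
  (\sum_(i < n) i.+1 * k i)%N = n -> forall i, (k i < n.+1)%N.
Proof.
move=> kE i; rewrite ltnS -[leqRHS]kE (bigD1 i) //=.
by rewrite mulSn -addnA leq_addr.
Qed.

(* Main.v *)
Require Import Defs.
From mathcomp Require Import all_boot all_order all_algebra.
From mathcomp Require Import ring.

(** Let [b] be the image of [x_1, x_2, ...] under Invert, and put [c 0 = 1]
    and [c n.+1 = b n]. The definition of Invert says that the generating
    series of [c] is [1 / (1 - (x_1 t + x_2 t^2 + ...))], that is, [c n = x_1
    * c (n - 1) + ... + x_n * c 0] for [n > 0] ([Invert_rec]). The multinomial
    sum obeys the same recurrence ([wsum_rec]). Indeed the multinomial
    coefficient of an exponent vector [k] counts the words with [k i] letters
    [i], and removing the first letter, [j], of a word of total weight [n]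
    leaves a word of weight [n - (j + 1)] (letters are numbered from [0], and
    letter [j] has weight [j + 1]). On one monomial term this is the Pascal
    rule [mterm_rec], summed over the letters [j] that occur in [k]; on the
    whole sum it is the reindexing of [wsum_shift]. The recurrence lowers [n],
    whereas the number of variables of the sum in the theorem is [n] itself;
    therefore the number of variables is a separate parameter [N], and
    [wsum_Invert] identifies [c n] for all [n <= N]. *)

Set Implicit Arguments.
Unset Strict Implicit.

Import Order.TTheory GRing.Theory Num.Theory.

Local Open Scope ring_scope.

Lemma Invert_rec (R : comUnitRingType) (a : nat -> R) (n : nat) :
  Invert a n = a n + \sum_(i < n) Invert a i * a (n - i.+1)%N.
Proof.
have denE m : fps_sub (@fps_one R) (fps_mul (@fps_t R) a) m
  = if m is m'.+1 then - a m' else 1.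
  rewrite /fps_sub /fps_mul /fps_one /fps_t; case: m => [|m].
    by rewrite big_ord1 mul0r subr0.
  rewrite 2!big_ord_recl big1 => [|i _]; last by rewrite mul0r.
  by rewrite /= mul0r mul1r subn1 add0r addr0 add0r.
rewrite {1}/Invert fps_divE denE divr1 -sumrN; congr (_ + _).
apply: eq_bigr => i _; rewrite -mulrN denE subnS.
move: (ltn_ord i); rewrite -subn_gt0.
by case: (n - i)%N => //= p _; rewrite opprK.
Qed.

(** * Multinomial terms and the Pascal rule *)

Section MultinomialTerm.
Variables (F : numFieldType) (I : finType) (y : I -> F).

Definition mterm (k : I -> nat) : F :=
  ((\sum_i k i)`!)%:R / (\prod_i (k i)`!)%:R * \prod_i y i ^+ k i.

Lemma eq_mterm (k l : I -> nat) : k =1 l -> mterm k = mterm l.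
Proof.
move=> kl; rewrite /mterm; congr (_`!%:R / _%:R * _);
  by apply: eq_bigr => i _; rewrite kl.
Qed.

Lemma mterm0 (k : I -> nat) : k =1 (fun=> 0%N) -> mterm k = 1.
Proof.
by move=> k0; rewrite (eq_mterm k0) /mterm !big1 ?fact0 ?divr1 ?mulr1.
Qed.

(** Both sides describe the words with one letter [j] more than [k] that begin
    with [j]: these are a fraction [(k j + 1) / (sum of k + 1)] of all such
    words. *)
Lemma mterm_incr (j : I) (k : I -> nat) :
  (\sum_i k i).+1%:R * (y j * mterm k) =
  (k j).+1%:R * mterm (fun i => k i + (i == j))%N.
Proof.
have sumE : (\sum_i (k i + (i == j)) = (\sum_i k i).+1)%N.
  by rewrite big_split /= -big_mkcond /= big_pred1_eq addn1.
have factE : (\prod_i (k i + (i == j))`! = (k j).+1 * \prod_i (k i)`!)%N.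
  rewrite (bigD1 j) //= [in RHS](bigD1 j) //= eqxx addn1 factS mulnA.
  by congr (_ * _)%N; apply: eq_bigr => i /negPf->; rewrite addn0.
have powE : \prod_i y i ^+ (k i + (i == j)) = y j * \prod_i y i ^+ k i.
  rewrite (bigD1 j) //= [in RHS](bigD1 j) //= eqxx addn1 exprS mulrA.
  by congr (_ * _); apply: eq_bigr => i /negPf->; rewrite addn0.
rewrite /mterm sumE factE powE factS !natrM invfM.
have nz : (k j).+1%:R != 0 :> F by rewrite pnatr_eq0.
have nz' : (\prod_i (k i)`!)%:R != 0 :> F.
  by rewrite pnatr_eq0 -lt0n prodn_gt0 // => i; rewrite fact_gt0.
by field; rewrite nz' nat1r nz.
Qed.

(** The summand for [j] collects the words whose first letter is [j]. *)
Lemma mterm_rec (k : I -> nat) : (0 < \sum_i k i)%N ->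
  mterm k = \sum_(j | (0 < k j)%N) y j * mterm (fun i => k i - (i == j))%N.
Proof.
move=> k_gt0.
have s_neq0 : (\sum_i k i)%:R != 0 :> F by rewrite pnatr_eq0 -lt0n.
apply: (mulfI s_neq0); rewrite mulr_sumr {1}natr_sum mulr_suml.
rewrite [LHS](bigID (fun j => 0 < k j)%N) /= [X in _ + X]big1 => [|j].
  rewrite addr0; apply: eq_bigr => j kj_gt0.
  have incrK i : ((k i - (i == j)) + (i == j))%N = k i.
    by case: eqP => [->|_]; rewrite ?subnK ?subn0 ?addn0.
  have kjE : ((k j - (j == j)).+1 = k j)%N by rewrite eqxx subn1 prednK.
  have sumE : ((\sum_i (k i - (i == j))).+1 = \sum_i k i)%N.
    under [in RHS]eq_bigr => i _ do rewrite -incrK.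
    by rewrite big_split /= -big_mkcond /= big_pred1_eq addn1.
  by rewrite -sumE mterm_incr kjE (@eq_mterm _ k).
by rewrite lt0n negbK => /eqP->; rewrite mul0r.
Qed.

End MultinomialTerm.

(** * Sums over exponent vectors of given weight *)

Section WeightedSum.
Variables (F : numFieldType) (N : nat) (y : 'I_N -> F).
Implicit Types (k : {ffun 'I_N -> 'I_N.+1}) (j : 'I_N).

Definition weight k : nat := (\sum_(i < N) i.+1 * k i)%N.

Definition wsum (n : nat) : F :=
  \sum_(k | weight k == n) mterm y (fun i => k i).

Lemma leq_weight k j : (j.+1 * k j <= weight k)%N.
Proof. by rewrite /weight (bigD1 j) //= leq_addr. Qed.

Lemma weight_eq0 k : (weight k == 0)%N = (k == [ffun=> ord0]).
Proof.
apply/idP/eqP => [/eqP w0 | ->].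
  apply/ffunP => i; apply/val_inj; rewrite ffunE /=; apply/eqP.
  by move: (leq_weight k i); rewrite w0 leqn0 muln_eq0.
by rewrite /weight big1 // => i _; rewrite ffunE muln0.
Qed.

Lemma wsum0 : wsum 0 = 1.
Proof.
rewrite /wsum (eq_bigl _ _ weight_eq0) big_pred1_eq mterm0 // => i.
by rewrite ffunE.
Qed.

Definition incr j k : {ffun 'I_N -> 'I_N.+1} :=
  [ffun i => inord (k i + (i == j))].

Definition decr j k : {ffun 'I_N -> 'I_N.+1} :=
  [ffun i => inord (k i - (i == j))].

Lemma decrE j k i : decr j k i = (k i - (i == j))%N :> nat.
Proof. by rewrite ffunE inordK // (leq_ltn_trans (leq_subr _ _)). Qed.

(** The bound keeps the [j]-th exponent inside ['I_N.+1] when it is raised. *)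
Lemma incrE j k i : (k j < N)%N -> incr j k i = (k i + (i == j))%N :> nat.
Proof.
move=> kj; rewrite ffunE inordK //.
by case: eqP => [->|_]; rewrite ?addn1 ?addn0.
Qed.

Lemma decrK j k : (0 < k j)%N -> incr j (decr j k) = k.
Proof.
move=> kj; apply/ffunP => i; apply/val_inj => /=; rewrite incrE !decrE.
  by case: eqP => [->|_]; rewrite ?subnK ?subn0 ?addn0.
by rewrite eqxx subn1 prednK // -ltnS.
Qed.

Lemma incrK j k : (k j < N)%N -> decr j (incr j k) = k.
Proof.
by move=> kj; apply/ffunP => i; apply/val_inj => /=; rewrite decrE incrE // addnK.
Qed.

Lemma weight_incr j k : (k j < N)%N -> weight (incr j k) = (weight k + j.+1)%N.
Proof.
move=> kj; rewrite /weight.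
under eq_bigr => i _ do rewrite incrE // mulnDr.
rewrite big_split /=; congr addn.
by rewrite (bigD1 j) //= eqxx muln1 big1 ?addn0 // => i /negPf->; rewrite muln0.
Qed.

(** Removing one letter [j] is a bijection from the exponent vectors of weight
    [n] in which [j] occurs to all those of weight [n - (j + 1)]; the inverse
    is well defined because [n <= N]. *)
Lemma wsum_shift n j : (n <= N)%N ->
  \sum_(k | (weight k == n) && (0 < k j)%N)
     mterm y (fun i => k i - (i == j))%N
  = if (j < n)%N then wsum (n - j.+1) else 0.
Proof.
move=> nN; case: ltnP => [jn | nj]; last first.
  rewrite big_pred0 // => k; apply/negP => /andP[/eqP wk kj].
  have := leq_weight k j; rewrite wk leqNgt => /negP; apply.
  by rewrite (leq_ltn_trans nj) // leq_pmulr.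
rewrite (reindex_onto (incr j) (decr j)) => [|k /andP[_ /decrK //]].
apply: eq_big => [k | k /andP[_ /eqP kE]]; last first.
  by apply: eq_mterm => i; rewrite -decrE kE.
case: (ltnP (k j) N) => [kj | kj].
  rewrite weight_incr // incrE // eqxx addn1 incrK // eqxx !andbT.
  by rewrite -(eqn_add2r j.+1 (weight k)) subnK.
have kjN : k j = N :> nat by apply/eqP; rewrite eqn_leq kj -ltnS ltn_ord.
transitivity false.
  (* Raising the exponent [N] overflows, and [inord] then returns [0]. *)
  by rewrite [incr j k j]ffunE eqxx addn1 kjN /inord /insubd insubF ?ltnn ?andbF.
apply/esym/negP => /eqP wk; have := leq_weight k j; rewrite kjN wk leqNgt.
case/negP; rewrite (@leq_trans N) //.
  by rewrite (leq_trans _ nN) // ltn_subrL (leq_trans _ jn).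
by rewrite leq_pmull.
Qed.

Lemma wsum_rec n : (0 < n <= N)%N ->
  wsum n = \sum_(j < N | (j < n)%N) y j * wsum (n - j.+1).
Proof.
case/andP=> n_gt0 nN; rewrite {1}/wsum.
transitivity (\sum_(k | weight k == n) \sum_(j | (0 < k j)%N)
                y j * mterm y (fun i => k i - (i == j))%N).
  apply: eq_bigr => k /eqP wk; rewrite mterm_rec // lt0n.
  apply: contraTN n_gt0; rewrite sum_nat_eq0 => /forallP k0.
  by rewrite -wk -eqn0Ngt /weight big1 // => i _; rewrite (eqP (k0 i)) muln0.
rewrite (exchange_big_dep predT) //= [RHS]big_mkcond /=.
apply: eq_bigr => j _; rewrite -mulr_sumr wsum_shift //.
by case: ifP; rewrite ?mulr0.
Qed.

End WeightedSum.

Lemma wsum_Invert (F : numFieldType) (N : nat) (a : nat -> F) (n : nat) :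
  (n <= N)%N ->
  wsum (fun i : 'I_N => a i) n = if n is m.+1 then Invert a m else 1.
Proof.
elim/ltn_ind: n => [[|n] IHn] nN; first by rewrite wsum0.
rewrite wsum_rec // -(big_ord_widen _ (fun j => a j * wsum _ (n.+1 - j.+1))) //.
rewrite Invert_rec big_ord_recr /= subnn wsum0 mulr1 addrC; congr (_ + _).
rewrite (reindex_inj rev_ord_inj); apply: eq_bigr => i _ /=.
have -> : (n.+1 - (n - i.+1).+1 = i.+1)%N by rewrite subSS subKn.
have lt_in : (i.+1 < n.+1)%N := ltn_ord i.
by rewrite mulrC IHn // (leq_trans (ltnW lt_in) nN).
Qed.

Lemma rmorph_Invert (R S : comUnitRingType) (f : {rmorphism R -> S})
    (a : nat -> R) (n : nat) :
  f (Invert a n) = Invert (fun m => f (a m)) n.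
Proof.
elim/ltn_ind: n => n IHn; rewrite !Invert_rec rmorphD rmorph_sum.
by congr (_ + _); apply: eq_bigr => i _; rewrite rmorphM IHn.
Qed.

Unset Implicit Arguments.

Theorem mainTheorem4 (x : nat -> nat) (n : nat) (hn : (1 <= n)%N) :
  ((Invert (fun m : nat => (x m.+1)%:Z) n.-1)%:~R : rat) =
  \sum_(k : {ffun 'I_n -> 'I_n.+1} | (\sum_(i < n) i.+1 * k i == n)%N)
    ((\sum_(i < n) k i)`!)%:R / (\prod_(i < n) (k i)`!)%:R
    * \prod_(i < n) (x i.+1)%:R ^+ k i.
Proof.
case: n hn => // n _.
rewrite -/(wsum (fun i : 'I_n.+1 => (fun m => (x m.+1)%:R) i) n.+1).
by rewrite wsum_Invert // -[LHS]/(intr _) rmorph_Invert.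
Qed.
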